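(* Let $k\ge 1$ and let $X_1,\dots,X_k$ be pairwise disjoint finite nonempty sets with $|X_i|=n_i$. Let $\mathrm{EC}$ be the set of eventually constant $k$-tuples $(f_1,\dots,f_k)$ of functions $f_i:X_i\to X_{i+1}$ (indices modulo $k$). Then $$\#\mathrm{EC}=\prod_{i=1}^k n_i^{\,n_{i-1}-1}\cdot\left(\prod_{j=1}^k n_j-\prod_{j=1}^k(n_j-1)\right).$$
   Context: Indices are modulo $k$, so $X_{k+1}=X_1$ and $n_0=n_k$. A $k$-tuple $(f_1,\dots,f_k)$ with $f_i:X_i\to X_{i+1}$ is eventually constant if the iterates of the composition $f_k\cdots f_1:X_1\to X_1$ eventually stabilize to a constant map, i.e. $(f_k\cdots f_1)^m$ is constant for some $m\ge1$. *)

(* Defs.v *)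
From mathcomp Require Import all_boot.
From mathcomp Require Import boolp.

Set Implicit Arguments.
Unset Strict Implicit.
Unset Printing Implicit Defensive.

(* Indices 1, ..., k of the mathematics are the elements 0, ..., k-1 of 'I_k;
   [ordS] and [ord_pred] are i |-> i + 1 and i |-> i - 1 modulo k.
   The sets X_1, ..., X_k are a family of finite types, so that elements with
   different indices are never identified (pairwise disjointness). *)

Definition fun_tuple (k : nat) (X : 'I_k -> finType) : finType :=
  {dffun forall i : 'I_k, {ffun X i -> X (ordS i)}}.

Lemma val_iter_ordS (k m : nat) (i : 'I_k) :
  iter m (@ordS k) i = (i + m) %% k :> nat.
Proof.
elim: m => [|m IHm] /=; first by rewrite addn0 modn_small.
by rewrite IHm -addn1 modnDml addn1 addnS.
Qed.

Lemma iter_ordS_period (k : nat) (i : 'I_k) : iter k (@ordS k) i = i.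
Proof. by apply: val_inj; rewrite /= val_iter_ordS modnDr modn_small. Qed.

Section Composite.

Variables (k : nat) (X : 'I_k -> finType) (f : fun_tuple X).

(* f_{i+m-1} ... f_{i+1} f_i : X_i -> X_{i+m} *)
Fixpoint partial_comp (i : 'I_k) (m : nat) : X i -> X (iter m (@ordS k) i) :=
  match m with
  | 0 => fun x => x
  | m'.+1 => fun x => f (iter m' (@ordS k) i) (partial_comp m' x)
  end.

(* f_{i-1} ... f_{i+1} f_i : X_i -> X_i, using X_{i+k} = X_i; for the first
   index this is f_k ... f_1. *)
Definition cyclic_comp (i : 'I_k) (x : X i) : X i :=
  ecast j (X j) (iter_ordS_period i) (partial_comp k x).

Definition eventually_constant (hk : 0 < k) : Prop :=
  let i1 := Ordinal hk in
  exists2 m : nat, 1 <= m &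
    exists c : X i1, forall x : X i1, iter m (@cyclic_comp i1) x = c.

End Composite.

Definition EC (k : nat) (hk : 0 < k) (X : 'I_k -> finType) :
    {set fun_tuple X} :=
  [set f | `[< eventually_constant f hk >]].

(* Main.v *)
Require Import Defs.
From mathcomp Require Import all_boot all_fingroup all_algebra.
From mathcomp Require Import boolp zify.

(* Let V be the disjoint union of the X_i.  A tuple f is a self-map F of V, and f
   is eventually constant iff F has a cycle x_1 -> ... -> x_k -> x_1 with one
   point in each X_i into which every orbit falls; this cycle is then unique.
   For a fixed section x = (x_i), the F that extend this cycle and have no other
   one are counted by a directed matrix-tree theorem, as the determinant of a
   matrix D - P Q with D diagonal and P, Q of inner size k.  It equals
   det D * det (1 - Q D^-1 P), where the last matrix is 1 minus a weighted
   k-cycle, of determinant 1 - prod (n_i - 1) / n_i.  There are prod n_i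
   sections x. *)

Set Implicit Arguments.
Unset Strict Implicit.
Unset Printing Implicit Defensive.

Import GRing.Theory Num.Theory.
Local Open Scope ring_scope.

(** Both sides equal the determinant of [block_mx 1%:M P Q 1%:M], factored into block-triangular
    matrices by eliminating [P] or [Q]. *)
Lemma det_1Bmulmx_swap (R : comNzRingType) m n
    (P : 'M[R]_(m, n)) (Q : 'M[R]_(n, m)) :
  \det (1%:M - P *m Q) = \det (1%:M - Q *m P).
Proof.
have <- : \det (block_mx 1%:M P Q 1%:M) = \det (1%:M - P *m Q).
  have -> : block_mx 1%:M P Q 1%:M =
      block_mx 1%:M P 0 1%:M *m block_mx (1%:M - P *m Q) 0 Q 1%:M.
    by rewrite mulmx_block !mul1mx !mulmx1 ?mulmx0 !mul0mx !add0r subrK.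
  by rewrite det_mulmx det_ublock det_lblock !det1 !mul1r mulr1.
have -> : block_mx 1%:M P Q 1%:M =
    block_mx 1%:M 0 Q 1%:M *m block_mx 1%:M P 0 (1%:M - Q *m P).
  by rewrite mulmx_block !mul1mx !mulmx1 ?mulmx0 !mul0mx !addr0 addrC subrK.
by rewrite det_mulmx det_ublock det_lblock !det1 !mul1r.
Qed.

(** Column 0 is supported in the first and last rows, and both minors are triangular: one has unit
    diagonal, the other has the entries [- a j] with j > 0. *)
Lemma det_1Bcycle (R : comNzRingType) n (a : 'I_n.+1 -> R) :
  \det (\matrix_(i, j) ((i == j)%:R - (j == ordS i)%:R * a j)) =
  1 - \prod_j a j.
Proof.
set A := \matrix_(i, j) _.
have ordS_lift0 (i : 'I_n.+1) (j : 'I_n) :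
    (lift ord0 j == ordS i) = (j == i :> nat).
  rewrite -val_eqE /= /bump leq0n add1n.
  have [ilt|ige] := ltnP i n; first by rewrite modn_small.
  have -> : i = n :> nat by apply/eqP; rewrite eqn_leq ige -ltnS ltn_ord.
  by rewrite modnn (ltn_eqF (ltn_ord j)).
have A0 i : A i ord0 = (i == ord0)%:R - (i == ord_max)%:R * a ord0.
  rewrite mxE; congr (_ - _%:R * _).
  have -> : ord0 = ordS (@ord_max n) by apply: val_inj; rewrite /= modnn.
  by rewrite (inj_eq (can_inj (@ordSK _))) eq_sym.
rewrite (expand_det_col A ord0); under [LHS]eq_bigr do rewrite A0 mulrBl.
rewrite sumrB (bigD1 ord0) //= big1 => [|i /negPf->]; last by rewrite mul0r.
rewrite mul1r addr0 (bigD1 ord_max) //=.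
rewrite [X in _ - (_ + X)]big1 => [|i /negPf->]; last by rewrite !mul0r.
rewrite eqxx mul1r addr0; congr (_ - _).
  rewrite /cofactor addn0 expr0 mul1r -det_tr det_trig => [|].
    rewrite big1 // => i _; rewrite !mxE ordS_lift0 (inj_eq lift_inj) eqxx.
    by rewrite /= /bump add1n ltn_eqF // mul0r subr0.
  apply/is_trig_mxP => i j ij; rewrite !mxE ordS_lift0 (inj_eq lift_inj).
  rewrite -val_eqE /= /bump add1n. rewrite gtn_eqF // ltn_eqF ?mul0r ?subr0 //.
  by rewrite ltnS ltnW.
have lift_max0 (i j : 'I_n) :
    (lift ord_max i == lift ord0 j) = (i == j.+1 :> nat).
  by rewrite -val_eqE [val _](lift_max i) /= /bump add1n.
rewrite /cofactor addn0 det_trig => [|]; last first.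
  apply/is_trig_mxP => i j ij; rewrite !mxE ordS_lift0 lift_max0 lift_max.
  by rewrite (gtn_eqF ij) mul0r subr0 ltn_eqF // ltnS ltnW.
under [X in _ * (_ * X)]eq_bigr => i _.
  rewrite !mxE ordS_lift0 lift_max0 lift_max ltn_eqF // eqxx mul1r sub0r; over.
rewrite big_ord_recl; congr (_ * _).
(* The cofactor sign (-1)^n cancels the n minus signs on the diagonal. *)
by rewrite prodrN card_ord mulrA -exprMn mulrNN mulr1 expr1n mul1r.
Qed.

(** * Directed matrix-tree theorem *)

Section FunctionalDigraphs.

Variable V : finType.
Implicit Types (F : {ffun V -> V}) (M : {set V}) (T : V -> {set V}).

Definition fin_mx (b : V -> V -> rat) : 'M_#|V| :=
  \matrix_(i, j) b (enum_val i) (enum_val j).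

(** Multilinearity in the rows: expanding a Leibniz product of sums amounts to choosing [F v] in
    [T v] for every [v]. *)
Lemma det_fin_mx_sum T (b : V -> V -> V -> rat) :
  \det (fin_mx (fun v u => \sum_(w in T v) b v w u)) =
  \sum_(F in family T) \det (fin_mx (fun v u => b v (F v) u)).
Proof.
rewrite exchange_big; apply: eq_bigr => s _ /=.
rewrite -mulr_sumr; congr (_ * _).
have prodE (g : 'I_#|V| -> rat) : \prod_i g i = \prod_v g (enum_rank v).
  by rewrite (reindex _ (onW_bij _ (enum_rank_bij V))).
rewrite prodE; under eq_bigr do rewrite mxE enum_rankK.
rewrite bigA_distr_big_dep; apply: eq_bigr => F _.
by rewrite prodE; apply: eq_bigr => v _; rewrite mxE enum_rankK.
Qed.

Definition escapes F M : bool :=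
  [forall v, [exists u in ~: M, fconnect F v u]].

Lemma escapesP F M :
  reflect (forall v, exists m, iter m F v \notin M) (escapes F M).
Proof.
apply: (iffP forallP) => esc v.
  have /exists_inP[u uM vu] := esc v.
  by exists (findex F v u); rewrite iter_findex // -in_setC.
have [m mM] := esc v; apply/exists_inP; exists (iter m F v).
  by rewrite in_setC.
exact: fconnect_iter.
Qed.

(** If every orbit leaves [M], then [F] has no cycle inside [M], so only the identity permutation
    contributes; otherwise the matrix is singular. *)
Lemma det_escapes F M :
  \det (fin_mx (fun v u => (v == u)%:R - ((v \in M) && (F v == u))%:R)) =
  (escapes F M)%:R.
Proof.
set A := fin_mx _.
case: escapesP => [esc|/existsNP[v0 stay]].
  rewrite /determinant (bigD1 1%g) //= odd_perm1 expr0 mul1r.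
  rewrite [X in _ + X]big1 ?addr0 => [|s s1].
    rewrite big1 // => i _; rewrite mxE perm1 eqxx.
    (* A diagonal entry other than 1 would come from a fixed point of [F] in [M], which never
       escapes. *)
    case: andP => [[vM /eqP Fv]|]; last by rewrite subr0.
    have [m] := esc (enum_val i); suff -> : iter m F (enum_val i) = enum_val i.
      by rewrite vM.
    by elim: m => //= m ->.
  have [i si] : exists i, s i != i.
    apply/existsP; rewrite -negb_forall; apply: contra s1 => /forallP sE.
    by apply/eqP/permP => i; rewrite perm1; apply/eqP.
  have [->|/prodf_neq0 A0] := eqVneq (\prod_j A j (s j)) 0.
    by rewrite mulr0.
  (* A nonzero Leibniz term of s <> 1 makes F follow s, trapping a point in M. *)
  have step p : (enum_val (iter p s i) \in M) &&
      (F (enum_val (iter p s i)) == enum_val (s (iter p s i))).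
    have := A0 (iter p s i) isT; rewrite mxE (inj_eq enum_val_inj).
    suff /negPf-> : iter p s i != s (iter p s i) by case: (_ && _).
    elim: p => [|p IHp] /=; first by rewrite eq_sym.
    by rewrite (inj_eq perm_inj).
  have [m] := esc (enum_val i).
  suff -> : iter m F (enum_val i) = enum_val (iter m s i).
    by case/andP: (step m) => ->.
  by elim: m => //= m ->; case/andP: (step m) => _ /eqP.
(* The indicator of the trapped points lies in the kernel of A. *)
pose trapped v := `[< forall m, iter m F v \in M >].
have trappedE v : trapped v = (v \in M) && trapped (F v).
  apply/asboolP/andP => [stay'|[vM /asboolP stay'] [|m]] //; last first.
    by rewrite iterSr.
  by split; [exact: (stay' 0%N) | apply/asboolP => m; rewrite -iterSr].
pose h : 'cV[rat]_#|V| := \col_i (trapped (enum_val i))%:R.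
have Ah : A *m h = 0.
  apply/colP => i; rewrite !mxE.
  under eq_bigr do rewrite !mxE mulrBl.
  set v := enum_val i; rewrite sumrB (bigD1 i) //= eqxx mul1r.
  rewrite big1 => [|j ji]; last first.
    by rewrite (inj_eq enum_val_inj) eq_sym (negPf ji) mul0r.
  rewrite (bigD1 (enum_rank (F v))) //= enum_rankK eqxx andbT.
  rewrite big1 => [|j ji].
    by rewrite !addr0 -natrM mulnb trappedE subrr.
  rewrite -{1}[F v]enum_rankK (inj_eq enum_val_inj) eq_sym (negPf ji).
  by rewrite andbF mul0r.
apply/eqP; rewrite -det_tr; apply/det0P; exists h^T.
  apply/eqP => /rowP/(_ (enum_rank v0)); rewrite !mxE enum_rankK => /eqP.
  rewrite pnatr_eq0 eqb0 => /negP; apply; apply/asboolP => m.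
  by apply: contra_notT stay => ?; exists m.
by rewrite -trmx_mul Ah trmx0.
Qed.

(* A directed matrix-tree theorem: by multilinearity the determinant is the sum
   over F of [det (1 - A_F)], where A_F is the adjacency matrix of F on M. *)
Lemma card_escapes T M :
  #|[set F in family T | escapes F M]|%:R =
  \det (fin_mx (fun v u =>
    #|T v|%:R * (v == u)%:R - ((v \in M) && (u \in T v))%:R)).
Proof.
rewrite -sum1dep_card natr_sum big_mkcondr /=.
under eq_bigr => F _.
  have -> : (if escapes F M then 1 else 0) = (escapes F M)%:R :> rat by case: ifP.
  rewrite -(det_escapes F M); over.
rewrite -(det_fin_mx_sum T
  (fun v w u => (v == u)%:R - ((v \in M) && (w == u))%:R)).
congr (\det _); apply/matrixP => i j; rewrite !mxE.
rewrite sumrB sumr_const [in RHS]mulr_natl; congr (_ - _).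
case: (_ \in M) => /=; last by rewrite big1.
case: (boolP (enum_val j \in T _)) => [jT|jT].
  rewrite (bigD1 _ jT) /= eqxx big1 ?addr0 // => u /andP[_ /negPf->] //.
by rewrite big1 // => u uT; case: eqP jT => // <-; rewrite uT.
Qed.

End FunctionalDigraphs.

Lemma big_enum_valT (R : Type) (idx : R) (op : Monoid.com_law idx) (V : finType)
    (G : V -> R) :
  \big[op/idx]_(p < #|V|) G (enum_val p) = \big[op/idx]_v G v.
Proof. by rewrite [RHS](reindex _ (onW_bij _ (enum_val_bij V))). Qed.

Lemma big_Tagged (R : Type) (idx : R) (op : Monoid.com_law idx) (I : finType)
    (X : I -> finType) (G : {i & X i} -> R) :
  \big[op/idx]_v G v = \big[op/idx]_i \big[op/idx]_(y : X i) G (Tagged X y).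
Proof.
rewrite (sig_big_dep xpredT (fun _ => xpredT) (fun i y => G (Tagged X y))).
by apply: eq_big => // -[].
Qed.

(** * Self-maps of the disjoint union with a prescribed cycle *)

Section CyclicFamily.

Variables (n : nat) (X : 'I_n.+1 -> finType).
Hypothesis X_gt0 : forall i, (0 < #|X i|)%N.

Notation V := {i : 'I_n.+1 & X i}.
Implicit Types (F : {ffun V -> V}) (f : fun_tuple X)
  (x : {dffun forall i, X i}).

Definition off_section (x : {dffun forall i, X i}) : {set V} :=
  [set v | tagged v != x (tag v)].

(** Maps in this family contain the cycle [x] and are otherwise free to send each fibre to the next;
    escaping [off_section x] means falling into the cycle. *)
Definition cyclic_targets (x : {dffun forall i, X i}) (v : V) : {set V} :=
  if v \in off_section x then [set u | tag u == ordS (tag v)]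
  else [set Tagged X (x (ordS (tag v)))].

Lemma Tagged_inj i : injective (Tagged X : X i -> V).
Proof. by move=> y z /eqP; rewrite eq_Tagged => /eqP. Qed.

Lemma card_tag_fiber i : #|[set v : V | tag v == i]| = #|X i|.
Proof.
rewrite -(card_imset predT (@Tagged_inj i)); apply: eq_card => v.
rewrite inE; apply/eqP/imsetP => [<-|[y _ ->]] //.
by exists (tagged v) => //; case: v.
Qed.

Lemma card_cyclic_targets x v :
  #|cyclic_targets x v| =
  if v \in off_section x then #|X (ordS (tag v))| else 1%N.
Proof.
by rewrite /cyclic_targets; case: ifP => _; rewrite ?cards1 ?card_tag_fiber.
Qed.

Lemma card_cyclic_escapes x :
  #|[set F in family (cyclic_targets x) | escapes F (off_section x)]|%:R =
  (\prod_i #|X (ordS i)| ^ (#|X i| - 1))%:R *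
  (1 - \prod_i ((#|X i| - 1)%:R / #|X i|%:R)) :> rat.
Proof.
have X_neq0 i : #|X i|%:R != 0 :> rat by rewrite pnatr_eq0 -lt0n.
rewrite card_escapes.
pose d v : rat := #|cyclic_targets x v|%:R.
have d_neq0 v : d v != 0.
  by rewrite /d card_cyclic_targets; case: ifP => // _; rewrite oner_neq0.
(* Off the section, the row of a point depends only on its tag, so the subtracted part factors
   through the indices. [P] already absorbs the inverse of the diagonal matrix. *)
pose P : 'M[rat]_(#|{: V}|, n.+1) := \matrix_(p, i)
  (((enum_val p \in off_section x) && (tag (enum_val p) == i))%:R /
   d (enum_val p)).
pose Q : 'M[rat]_(n.+1, #|{: V}|) :=
  \matrix_(i, q) (tag (enum_val q) == ordS i)%:R.
have -> : fin_mx (fun v u => #|cyclic_targets x v|%:R * (v == u)%:R -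
      ((v \in off_section x) && (u \in cyclic_targets x v))%:R) =
    diag_mx (\row_p d (enum_val p)) *m (1%:M - P *m Q).
  apply/matrixP => p q; rewrite mul_diag_mx !mxE mulrBr (inj_eq enum_val_inj).
  congr (_ - _); rewrite (bigD1 (tag (enum_val p))) //= big1 => [|i iNp].
    rewrite !mxE addr0 eqxx andbT mulrA [d _ * _]mulrC divfK // -natrM mulnb.
    rewrite /cyclic_targets; case: ifP => //= _.
    by rewrite inE.
  by rewrite !mxE eq_sym (negPf iNp) andbF !mul0r.
rewrite det_mulmx det_1Bmulmx_swap det_diag; congr (_ * _).
  (* In the fibre over [i], the section point has weight 1 and the [#|X i| - 1] others have weight
     [#|X (ordS i)|]. *)
  under eq_bigr do rewrite mxE.
  rewrite (big_enum_valT _ d) big_Tagged natr_prod.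
  apply: eq_bigr => i _; rewrite natrX (bigD1 (x i)) //=.
  rewrite /d card_cyclic_targets inE eqxx mul1r.
  rewrite (eq_bigr (fun=> #|X (ordS i)|%:R)) => [|y yx].
    by rewrite prodr_const cardC1 subn1.
  by rewrite card_cyclic_targets inE yx.
have -> : 1%:M - Q *m P = \matrix_(i, j)
    ((i == j)%:R - (j == ordS i)%:R * ((#|X j| - 1)%:R / #|X (ordS j)|%:R)).
  apply/matrixP => i j; rewrite !mxE; congr (_ - _).
  under eq_bigr do rewrite !mxE.
  rewrite (big_enum_valT _ (fun v => (tag v == ordS i)%:R *
    (((v \in off_section x) && (tag v == j))%:R / d v))) big_Tagged.
  rewrite (bigD1 j) //= [X in _ + X]big1 ?addr0 => [|l lj]; last first.
    by rewrite big1 // => y _; rewrite (negPf lj) andbF mul0r mulr0.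
  rewrite -mulr_sumr; congr (_ * _).
  rewrite (bigD1 (x j)) //= inE /= eqxx /= mul0r add0r.
  rewrite (eq_bigr (fun=> #|X (ordS j)|%:R^-1)) => [|y yx].
    by rewrite sumr_const cardC1 subn1 mulr_natl.
  by rewrite /d card_cyclic_targets inE yx eqxx mul1r.
rewrite det_1Bcycle !prodf_div; congr (1 - _ / _).
by rewrite [RHS](reindex_inj (can_inj (@ordSK _))).
Qed.

(** * Eventually constant tuples as self-maps of the disjoint union *)

Local Open Scope nat_scope.
Definition total_map f : {ffun V -> V} :=
  [ffun v => Tagged X (f (tag v) (tagged v))].

Lemma total_map_inj : injective total_map.
Proof.
move=> f g /ffunP fg; apply/ffunP => i; apply/ffunP => y.
by have := fg (Tagged X y); rewrite !ffunE => /Tagged_inj.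
Qed.

Lemma total_map_surj F :
  (forall v, tag (F v) = ordS (tag v)) -> exists f, total_map f = F.
Proof.
move=> tagF.
have gP i (y : X i) : exists z : X (ordS i), Tagged X z = F (Tagged X y).
  have := tagF (Tagged X y); case: (F _) => j z /= jE.
  by case: _ / jE in z *; exists z.
have [g gE] := fin_all_exists (fun i => fin_all_exists (gP i)).
exists [ffun i => [ffun y => g i y]]; apply/ffunP => -[i y].
by rewrite !ffunE /= gE.
Qed.

Lemma tag_total_map f v : tag (total_map f v) = ordS (tag v).
Proof. by rewrite ffunE. Qed.

(** In the sigma type the transport [ecast] disappears, and one turn of the composite is [n.+1]
    steps. *)
Lemma iter_cyclic_comp f m i (y : X i) :
  Tagged X (iter m (@cyclic_comp _ X f i) y) =
  iter (m * n.+1) (total_map f) (Tagged X y).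
Proof.
have partialE p (z : X i) :
    Tagged X (partial_comp f p z) = iter p (total_map f) (Tagged X z).
  by elim: p => //= p <-; rewrite ffunE.
have ecastE j l (e : j = l) (z : X j) : Tagged X (ecast a (X a) e z) = Tagged X z.
  by case: _ / e.
elim: m => // m IHm; rewrite mulSn iterD -IHm -partialE.
exact: ecastE.
Qed.

Lemma tag_iter_total_map f m v :
  tag (iter m (total_map f) v) = (tag v + m) %% n.+1 :> nat.
Proof.
rewrite -val_iter_ordS; congr val.
by elim: m => //= m <-; rewrite tag_total_map.
Qed.

Lemma cyclic_targetsP f x :
  reflect (forall i, total_map f (Tagged X (x i)) = Tagged X (x (ordS i)))
          (total_map f \in family (cyclic_targets x)).
Proof.
apply: (iffP familyP) => [fx i|fx v].
  by have := fx (Tagged X (x i)); rewrite /cyclic_targets inE /= eqxx inE => /eqP.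
rewrite /cyclic_targets; case: ifPn; rewrite !inE ?tag_total_map //.
by case: v => i y /negPn/eqP /= ->; rewrite fx.
Qed.

Lemma mem_section v x : (v \notin off_section x) = (v == Tagged X (x (tag v))).
Proof. by case: v => i y; rewrite inE negbK eq_Tagged. Qed.

(* [f] is eventually constant iff it has a cycle through exactly one point of
   each [X i] into which every orbit falls. *)
Lemma eventually_constantP f (hk : (0 < n.+1)%N) :
  eventually_constant f hk <->
  exists x, total_map f \in family (cyclic_targets x) /\
            escapes (total_map f) (off_section x).
Proof.
set F := total_map f; have -> : hk = isT by exact: bool_irrelevance.
rewrite /eventually_constant /=; set i1 := Ordinal _.
split=> [[m m_gt0 [c cE]]|[x [/cyclic_targetsP fx /escapesP esc]]].
  pose v0 := Tagged X c.
  have toc y : iter (m * n.+1) F (Tagged X (y : X i1)) = v0.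
    by rewrite -iter_cyclic_comp cE.
  have toc' v : tag v = i1 -> iter (m * n.+1) F v = v0.
    by case: v => i y /= iE; case: _ / (esym iE) in y *; exact: toc.
  have tagF p : tag (iter p F v0) = p %% n.+1 :> nat.
    by rewrite tag_iter_total_map.
  (* The iterate sending the whole first fibre to [v0] commutes with [iter n.+1 F], which preserves
     that fibre. Hence the orbit of [v0] closes up after one turn. *)
  have Fk : iter n.+1 F v0 = v0.
    rewrite -{1}(toc c) -iterD addnC iterD -[RHS](toc' (iter n.+1 F v0)) //.
    by apply: val_inj; rewrite [LHS](tagF n.+1) modnn.
  have xP i : exists y : X i, Tagged X y = iter i F v0.
    have : tag (iter i F v0) = i by apply: val_inj; rewrite [LHS]tagF modn_small.
    by case: (iter _ _ _) => j z /= jE; case: _ / jE in z *; exists z.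
  have [x xE] := fin_all_exists xP.
  pose s : {dffun forall i, X i} := [ffun i => x i].
  have sE i : Tagged X (s i) = iter i F v0 by rewrite ffunE.
  exists s; split.
    apply/cyclic_targetsP => i; rewrite !sE -[LHS]/(iter i.+1 F v0) /=.
    have [ilt|ige] := ltnP i n; first by rewrite modn_small.
    have -> : i = n :> nat by apply/eqP; rewrite eqn_leq ige -ltnS ltn_ord.
    by rewrite modnn.
  (* First move [v] to the fibre of index 0, then collapse it to [v0]. *)
  apply/escapesP => v; exists (m * n.+1 + (n.+1 - tag v))%N.
  rewrite mem_section sE iterD toc' //.
  by apply: val_inj; rewrite [LHS]tag_iter_total_map subnKC ?modnn // ltnW.
have [p pE] := fin_all_exists esc.
have stay v q : v \notin off_section x -> iter q F v \notin off_section x.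
  move=> vx; elim: q => //= q; rewrite mem_section => /eqP->.
  by rewrite fx inE negbK.
(* This many turns exceed every escape time and return to the starting fibre; the successor makes
   the exponent positive. *)
exists (\max_v p v).+1 => //; exists (x i1) => y.
apply: (@Tagged_inj i1); rewrite iter_cyclic_comp.
set q := (_ * _)%N.
have q_ge : (p (Tagged X y) <= q)%N.
  by rewrite (leq_trans (leq_bigmax (Tagged X y))) // /q mulSn mulnS; lia.
have := stay _ (q - p (Tagged X y))%N (pE (Tagged X y)).
rewrite -iterD subnK // mem_section => /eqP ->.
suff -> : tag (iter q F (Tagged X y)) = i1 by [].
by apply: val_inj; rewrite [LHS]tag_iter_total_map /= add0n modnMl.
Qed.

(** An orbit along [y] must meet [x]; from a common point, following [f] around the cycle recovers
    both sections. *)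
Lemma cyclic_section_uniq f x (y : {dffun forall i, X i}) :
  total_map f \in family (cyclic_targets x) ->
  escapes (total_map f) (off_section x) ->
  total_map f \in family (cyclic_targets y) -> x = y.
Proof.
move=> /cyclic_targetsP fx /escapesP esc /cyclic_targetsP fy.
have iterE (z : {dffun forall i, X i}) m i :
    (forall j, total_map f (Tagged X (z j)) = Tagged X (z (ordS j))) ->
    iter m (total_map f) (Tagged X (z i)) = Tagged X (z (iter m (@ordS _) i)).
  by move=> fz; elim: m => //= m ->.
have [m] := esc (Tagged X (y ord0)); rewrite iterE // inE negbK /= => /eqP.
move: (iter m _ ord0) => {m} i yx; apply/ffunP => j.
have -> : j = iter (j + (n.+1 - i)) (@ordS _) i.
  apply: val_inj; rewrite [RHS]val_iter_ordS addnCA subnKC ?modnDr ?modn_small //.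
  exact: ltnW.
by apply: Tagged_inj; rewrite -!iterE // yx.
Qed.

(** Double counting of pairs (f, x): an eventually constant [f] has exactly one cycle [x], any other
    [f] has none. *)
Lemma card_EC (hk : (0 < n.+1)%N) :
  #|EC hk X| = (\sum_(x : {dffun forall i, X i})
    #|[set F in family (cyclic_targets x) | escapes F (off_section x)]|)%N.
Proof.
pose S x := [set F in family (cyclic_targets x) | escapes F (off_section x)].
rewrite -[RHS]/(\sum_x #|S x|)%N.
(* Maps in [S x] advance tags by one, so each comes from a unique tuple. *)
have SE x : #|S x| = (\sum_f (total_map f \in S x))%N.
  rewrite -big_mkcond sum1_card /= -(card_imset _ total_map_inj).
  apply: eq_card => F; apply/idP/imsetP => [FS|[f fS ->] //].
  have [|f fE] := @total_map_surj F; last by exists f; rewrite // -topredE /= fE.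
  move: FS; rewrite inE => /andP[/familyP FT _] v; move: (FT v).
  by rewrite /cyclic_targets; case: ifP => _; rewrite inE => /eqP // ->.
under eq_bigr do rewrite SE.
rewrite exchange_big -sum1_card big_mkcond; apply: eq_bigr => f _ /=.
rewrite inE; case: asboolP => [/eventually_constantP[x [fx esc]]|nec].
  rewrite (bigD1 x) //= inE fx esc big1 // => y /eqP yx.
  apply/eqP; rewrite eqb0 inE; apply/negP => /andP[fy _].
  by apply: yx; rewrite (cyclic_section_uniq fx esc fy).
rewrite big1 // => x _; apply/eqP; rewrite eqb0 inE; apply/negP => /andP[fx esc].
by apply: nec; apply/eventually_constantP; exists x.
Qed.

End CyclicFamily.

Local Open Scope nat_scope.

(* For nonempty X i, the nat predecessors and the subtraction are exact. *)
Theorem proposition1p2 (k : nat) (hk : 0 < k) (X : 'I_k -> finType)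
    (hX : forall i : 'I_k, 0 < #|X i|) :
  #|EC hk X| =
    (\prod_(i < k) #|X i| ^ (#|X (ord_pred i)| - 1)) *
    (\prod_(j < k) #|X j| - \prod_(j < k) (#|X j| - 1)).
Proof.
case: k hk X hX => // n hk X hX.
have card_sections : #|{dffun forall i, X i}| = \prod_(i < n.+1) #|X i|.
  by rewrite card_dep_ffun foldrE big_image.
have le_prod : \prod_(j < n.+1) (#|X j| - 1) <= \prod_(j < n.+1) #|X j|.
  by apply: leq_prod => j _; rewrite leq_subr.
have n_neq0 : (\prod_(j < n.+1) #|X j|%:R != 0 :> rat)%R.
  by apply/prodf_neq0 => j _; rewrite pnatr_eq0 -lt0n.
apply/eqP; rewrite -(eqr_nat rat) card_EC natr_sum.
under eq_bigr do rewrite (card_cyclic_escapes hX).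
rewrite sumr_const card_sections.
rewrite -(mulr_natr _ (\prod_(i < n.+1) #|X i|)) natrM natrB //.
rewrite prodf_div !natr_prod -mulrA mulrBl mul1r divfK //.
apply/eqP; congr (_ * _)%R; rewrite -!natr_prod; congr (_%:R)%R.
(* Shifting by [ordS] turns the exponents at [ord_pred i] into exponents at [i]. *)
rewrite [RHS](reindex_inj (can_inj (@ordSK _))).
by apply: eq_bigr => i _; rewrite ordSK.
Qed.
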